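(* For all $t\in\mathbb{R}\setminus\{0\}$ one has $$\left\|e^{-it\Delta^2}\right\|_{\ell^1(\mathbb{Z})\to\ell^\infty(\mathbb{Z})}\lesssim|t|^{-\frac14},$$ with implied constant independent of $t$.
   Context: $(\Delta\phi)(n)=\phi(n+1)+\phi(n-1)-2\phi(n)$ is the discrete Laplacian on $\ell^2(\mathbb{Z})$ and $\Delta^2$ is its square, a bounded self-adjoint operator on $\ell^2(\mathbb{Z})$. $a\lesssim b$ means $a\le cb$ for some constant $c>0$. *)

(* Defs.v *)
From HB Require Import structures.
From mathcomp Require Import all_boot all_order all_algebra finmap.
From mathcomp Require Import all_classical all_reals all_analysis.
From mathcomp Require Import complex.
From mathcomp Require Import ring lra.

Set Implicit Arguments.
Unset Strict Implicit.
Unset Printing Implicit Defensive.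

Import Order.TTheory GRing.Theory Num.Theory.
Import numFieldNormedType.Exports.
Import Normc.

Local Open Scope classical_set_scope.
Local Open Scope ring_scope.
Local Open Scope complex_scope.

(* The l^p(Z) norm of a complex sequence, in the extended reals; same shape
   as the library's Lnorm, which only handles functions into \bar R.  The
   value at p = -oo is junk. *)
Definition lnorm (R : realType) (p : \bar R) (phi : int -> R[i]) : \bar R :=
  match p with
  | r%:E => ((\esum_(n in [set: int]) ((normc (phi n) `^ r)%:E)) `^ r^-1)%E
  | +oo%E => ereal_sup [set (normc (phi n))%:E | n in [set: int]]
  | -oo%E => 0%E
  end.

Arguments lnorm {R} p phi : simpl never.

Section SquareSums.
Variable R : realType.
Implicit Types (phi psi : int -> R[i]) (r s : R) (X : {fset int}).

(* |phi|_2 <= r, see lnorm2_le. *)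
Definition l2_le phi r :=
  0 <= r /\ forall X, \sum_(n <- X) normc (phi n) ^+ 2 <= r ^+ 2.

Lemma normc_ge0 (z : R[i]) : 0 <= normc z.
Proof. by case: z => a b; exact: sqrtr_ge0. Qed.

Lemma poweR2_le (x : \bar R) r : (0 <= x)%E -> 0 <= r ->
  (x `^ 2^-1 <= r%:E)%E <-> (x <= (r ^+ 2)%R%:E)%E.
Proof.
case: x => [x||]; rewrite ?poweRyr ?invr_eq0 ?pnatr_eq0 ?leye_eq//.
rewrite poweR_EFin !lee_fin => x0 r0; rewrite powR12_sqrt//.
by rewrite -[X in _ <= X](ger0_norm r0) -sqrtr_sqr ler_sqrt ?sqr_ge0.
Qed.

Lemma lnorm2_le phi r : 0 <= r -> (lnorm 2%:E phi <= r%:E)%E <-> l2_le phi r.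
Proof.
move=> r0; rewrite /lnorm poweR2_le//; last first.
  by apply: esum_ge0 => n _; rewrite lee_fin powR_ge0.
have ptE X : (\sum_(n \in [set` X]) (normc (phi n) `^ 2)%:E =
   (\sum_(n <- X) normc (phi n) ^+ 2)%R%:E :> \bar R)%E.
  rewrite fsbig_finite//= set_fsetK sumEFin; congr EFin.
  by apply: eq_bigr => n _; rewrite powR_mulrn ?normc_ge0.
split=> [h|[_ h]].
  split=> // X; rewrite -lee_fin -ptE (le_trans _ h)//.
  by apply: ereal_sup_ubound; exists [set` X].
apply: ge_ereal_sup => _ [A [finA _] <-].
by rewrite -(fset_setK finA) ptE lee_fin.
Qed.

Lemma lnorm2_le1 phi : (lnorm 2%:E phi <= 1)%E <-> l2_le phi 1.
Proof. exact: lnorm2_le. Qed.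

Lemma l2_le_pt phi r n : l2_le phi r -> normc (phi n) <= r.
Proof.
move=> [r0 /(_ [fset n]%fset)]; rewrite big_seq_fset1.
by rewrite ler_pXn2r ?nnegrE ?normc_ge0.
Qed.

Lemma l2_le0 r : 0 <= r -> l2_le (fun=> 0) r.
Proof.
move=> r0; split=> // X; rewrite big1 ?sqr_ge0// => n _.
by rewrite normc0 expr0n.
Qed.

Lemma l2_leW phi r s : r <= s -> l2_le phi r -> l2_le phi s.
Proof.
move=> rs [r0 h]; split; first exact: le_trans rs.
by move=> X; rewrite (le_trans (h X))// ler_pXn2r ?nnegrE// (le_trans r0).
Qed.

Lemma l2_leZ (c : R[i]) phi r :
  l2_le phi r -> l2_le (fun n => c * phi n) (normc c * r).
Proof.
move=> [r0 h]; split; first by rewrite mulr_ge0 ?normc_ge0.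
move=> X; under eq_bigr => n _ do rewrite normcM exprMn.
by rewrite -mulr_sumr exprMn ler_wpM2l ?sqr_ge0.
Qed.

Lemma l2_leD phi psi r s : l2_le phi r -> l2_le psi s ->
  l2_le (fun n => phi n + psi n) (r + s).
Proof.
move=> hr hs; have [r0 hX] := hr; have [s0 hY] := hs.
have [r00|rp] := eqVneq r 0.
  suff -> : (fun n => phi n + psi n) = psi by rewrite r00 add0r.
  apply/funext => n; have := l2_le_pt n hr; rewrite r00 => hn.
  have /eq0_normc -> : normc (phi n) = 0.
    by apply/eqP; rewrite eq_le hn normc_ge0.
  by rewrite add0r.
have [s00|sp] := eqVneq s 0.
  suff -> : (fun n => phi n + psi n) = phi by rewrite s00 addr0.
  apply/funext => n; have := l2_le_pt n hs; rewrite s00 => hn.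
  have /eq0_normc -> : normc (psi n) = 0.
    by apply/eqP; rewrite eq_le hn normc_ge0.
  by rewrite addr0.
have {rp} rp : 0 < r by rewrite lt_neqAle eq_sym rp.
have {sp} sp : 0 < s by rewrite lt_neqAle eq_sym sp.
split; first exact: addr_ge0.
move=> X; rewrite -(ler_pM2l (mulr_gt0 rp sp)) mulr_sumr.
apply: (@le_trans _ _ (\sum_(n <- X) (s * (r + s) * normc (phi n) ^+ 2
                                     + r * (r + s) * normc (psi n) ^+ 2))).
  apply: ler_sum => n _.
  have : normc (phi n + psi n) <= normc (phi n) + normc (psi n).
    exact: le_normcD.
  have := normc_ge0 (phi n + psi n).
  move: (normc (_ + _)) => c; move: (normc _) (normc _) => b a c0 cab.
  have c2 : c ^+ 2 <= (a + b) ^+ 2.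
    by have ab0 := le_trans c0 cab; rewrite ler_pXn2r ?nnegrE.
  apply: (@le_trans _ _ (r * s * (a + b) ^+ 2)).
    by rewrite ler_pM2l// mulr_gt0.
  rewrite -subr_ge0.
  rewrite (_ : _ - _ = (s * a - r * b) ^+ 2) ?sqr_ge0//; ring.
rewrite big_split/= -!mulr_sumr.
apply: (@le_trans _ _ (s * (r + s) * r ^+ 2 + r * (r + s) * s ^+ 2)).
  by apply: lerD; rewrite ler_wpM2l// mulr_ge0// addr_ge0.
rewrite le_eqVlt; apply/orP; left; apply/eqP; ring.
Qed.

Lemma l2_le_shift (k : int) phi r : l2_le phi r -> l2_le (fun n => phi (n + k)) r.
Proof.
move=> [r0 h]; split=> // X.
have := h [fset (n + k)%R | n : int in X]%fset.
by rewrite big_imfset//= => x y _ _ /addIr.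
Qed.

Lemma l2_le_sum (N : nat) (f : nat -> int -> R[i]) (g : nat -> R) :
  (forall k, l2_le (f k) (g k)) ->
  l2_le (fun n => \sum_(k < N) f k n) (\sum_(k < N) g k).
Proof.
move=> h; elim: N => [|N IH].
  by under eq_fun do rewrite big_ord0; rewrite big_ord0; exact: l2_le0.
under eq_fun do rewrite big_ord_recr; rewrite big_ord_recr.
exact: l2_leD.
Qed.

End SquareSums.
Definition ell2_pred (R : realType) : {pred int -> R[i]} :=
  mem [set phi : int -> R[i] | (lnorm 2%:E phi < +oo)%E].

Record ell2 (R : realType) :=
  Ell2 { ell2_fun :> int -> R[i] ; ell2_funP : ell2_fun \in @ell2_pred R }.

HB.instance Definition _ (R : realType) := [isSub for @ell2_fun R].
HB.instance Definition _ (R : realType) := [Choice of ell2 R by <:].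

Section Ell2.
Variable R : realType.
Implicit Types phi : int -> R[i].

Lemma ell2_predP phi : phi \in @ell2_pred R <-> exists r, l2_le phi r.
Proof.
rewrite inE/=; split=> [h|[r h]]; last first.
  have r0 : 0 <= r by case: h.
  by rewrite (le_lt_trans (proj2 (lnorm2_le phi r0) h)) ?ltry.
have h0 : (0 <= lnorm 2%:E phi)%E by exact: poweR_ge0.
have hf : lnorm 2%:E phi \is a fin_num by rewrite ge0_fin_numE.
exists (fine (lnorm 2%:E phi)); apply/lnorm2_le; first exact: fine_ge0.
by rewrite fineK.
Qed.

Lemma ell1_ell2 phi : (lnorm 1%:E phi < +oo)%E -> phi \in @ell2_pred R.
Proof.
rewrite /lnorm invr1 poweRe1; last first.
  by apply: esum_ge0 => n _; rewrite lee_fin powR_ge0.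
set S := (\esum_(n in _) _)%E => Sy.
have S0 : (0 <= S)%E by apply: esum_ge0 => n _; rewrite lee_fin powR_ge0.
have SE : (fine S)%:E = S by rewrite fineK// ge0_fin_numE.
apply/ell2_predP; exists (fine S); split=> [|X]; first exact: fine_ge0.
have sX : \sum_(n <- X) normc (phi n) <= fine S.
  rewrite -lee_fin SE; apply: ereal_sup_ubound; exists [set` X] => //.
  rewrite fsbig_finite//= set_fsetK sumEFin; congr EFin.
  by apply: eq_bigr => n _; rewrite powRr1 ?normc_ge0.
have [h0 h] : 0 <= \sum_(n <- X) normc (phi n) /\
    \sum_(n <- X) normc (phi n) ^+ 2 <= (\sum_(n <- X) normc (phi n)) ^+ 2.
  elim: (enum_fset X) => [|n s [IH0 IH]]; first by rewrite !big_nil expr0n.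
  rewrite !big_cons; split; first by rewrite addr_ge0 ?normc_ge0.
  have := normc_ge0 (phi n); move: (normc _) => a a0.
  have := mulr_ge0 a0 IH0; nra.
by rewrite (le_trans h)// ler_pXn2r ?nnegrE ?fine_ge0.
Qed.

Lemma ell2_submod_closed : submod_closed (@ell2_pred R).
Proof.
split=> [|c phi psi /ell2_predP[r hr] /ell2_predP[s hs]]; apply/ell2_predP.
  by exists 0; exact: l2_le0.
by exists (normc c * r + s); exact: l2_leD (l2_leZ c hr) hs.
Qed.

HB.instance Definition _ :=
  GRing.isSubmodClosed.Build R[i] (int -> R[i]) (@ell2_pred R)
    ell2_submod_closed.

HB.instance Definition _ := [SubChoice_isSubLmodule of ell2 R by <:].

Lemma ell2_ext (f g : ell2 R) : (forall n, f n = g n) -> f = g.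
Proof. by move=> fg; apply: val_inj; apply/funext. Qed.

Lemma ell2DE (f g : ell2 R) n : (f + g) n = f n + g n.
Proof. by []. Qed.

Lemma ell2NE (f : ell2 R) n : (- f) n = - f n.
Proof. by []. Qed.

Lemma ell2ZE (c : R[i]) (f : ell2 R) n : (c *: f) n = c * f n.
Proof. by []. Qed.

Lemma ell20E n : (0 : ell2 R) n = 0.
Proof. by []. Qed.

Lemma ell2_sumE (N : nat) (F : nat -> ell2 R) n :
  (\sum_(k < N) F k) n = \sum_(k < N) F k n.
Proof.
elim: N => [|N IH]; first by rewrite !big_ord0.
by rewrite big_ord_recr ell2DE IH big_ord_recr.
Qed.

End Ell2.

Section Laplacian.
Variable R : realType.

Definition laplacian_fun (phi : int -> R[i]) (n : int) : R[i] :=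
  phi (n + 1) + phi (n - 1) - 2 * phi n.

Lemma l2_le_laplacian phi r : l2_le phi r -> l2_le (laplacian_fun phi) (4 * r).
Proof.
move=> h; have h2 := l2_leZ (- 2) h.
have := l2_leD (l2_leD (l2_le_shift 1 h) (l2_le_shift (-1) h)) h2.
have -> : normc (- 2 : R[i]) = 2.
  by rewrite normcN -[X in normc X]/(1 *+ 2) normcMn normc1.
have -> : r + r + 2 * r = 4 * r by ring.
by under eq_fun do rewrite mulNr.
Qed.

Lemma laplacian_subproof (phi : ell2 R) : laplacian_fun phi \in @ell2_pred R.
Proof.
have /ell2_predP[r h] := ell2_funP phi.
by apply/ell2_predP; exists (4 * r); exact: l2_le_laplacian.
Qed.

Definition laplacian (phi : ell2 R) : ell2 R := Ell2 (laplacian_subproof phi).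

Lemma laplacianE (f : ell2 R) n : laplacian f n = laplacian_fun f n.
Proof. by []. Qed.

Lemma laplacian_linear : linear laplacian.
Proof.
move=> c f g; apply: ell2_ext => n.
by rewrite ell2DE ell2ZE !laplacianE /laplacian_fun !ell2DE !ell2ZE; ring.
Qed.

End Laplacian.

Section Operators.
Variable R : realType.

(* The l^p -> l^q norm of an operator T given on l^2(Z).  For p <= 2 the space
   l^p(Z) is contained in l^2(Z) (see ell1_ell2), so that no phi in l^p(Z) is
   left out of the supremum. *)
Definition opnorm (p q : \bar R) (T : ell2 R -> ell2 R) : \bar R :=
  ereal_sup [set lnorm q (T phi) |
             phi in [set phi : ell2 R | (lnorm p phi <= 1)%E]].

Definition exp_partial (A : ell2 R -> ell2 R) (N : nat) (phi : ell2 R) :=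
  \sum_(k < N) (k`!%:R : R[i])^-1 *: iter k A phi.

(* U is the sum of the exponential series of A, in the norm of bounded
   operators on l^2(Z). *)
Definition is_opexp (A U : ell2 R -> ell2 R) : Prop :=
  linear U /\
  (fun N => opnorm 2%:E 2%:E (fun phi => U phi - exp_partial A N phi))
    @ \oo --> 0%E.

(* Defined by the choice operator, as lim is; see opexpP and opexp_unique. *)
Definition opexp (A : ell2 R -> ell2 R) : ell2 R -> ell2 R :=
  xget (fun=> 0) [set U | is_opexp A U].

End Operators.

Section OpexpTheory.
Variable R : realType.
Implicit Types A U V T : ell2 R -> ell2 R.

Lemma linZ T c f : linear T -> T (c *: f) = c *: T f.
Proof.
move=> lT; have T0 : T 0 = 0.
  have := lT (-1) 0 0; rewrite scaler0 addr0 => ->.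
  by rewrite scaleN1r addNr.
by have := lT c f 0; rewrite !addr0 T0 addr0.
Qed.

Lemma ell2_bound (f : ell2 R) : exists2 r, 0 < r & l2_le f r.
Proof.
have /ell2_predP[r hr] := ell2_funP f.
exists (r + 1); first by case: hr => r0 _; rewrite ltr_wpDl.
by apply: l2_leW hr; rewrite lerDl.
Qed.

Lemma normc_real (x : R) : 0 <= x -> normc x%:C = x.
Proof. by move=> x0; rewrite /= expr0n/= addr0 sqrtr_sqr ger0_norm. Qed.

Lemma l2_normalize T (f : ell2 R) r : linear T -> l2_le f r -> 0 < r ->
  exists g : ell2 R, [/\ f = r%:C *: g, T f = r%:C *: T g & l2_le g 1].
Proof.
move=> lT hr r0.
have c0 : r%:C != 0 :> R[i].
  by apply/eqP => -[] /eqP; rewrite gt_eqF.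
exists (r%:C^-1 *: f).
have ef : f = r%:C *: (r%:C^-1 *: f) by rewrite scalerA divff// scale1r.
split=> //; first by rewrite -linZ// -ef.
have := l2_leZ (r%:C^-1) hr.
by rewrite normcV normc_real ?ltW// mulVf ?gt_eqF.
Qed.

Lemma opnorm2_le T M : linear T -> 0 <= M ->
  (opnorm 2%:E 2%:E T <= M%:E)%E <->
  forall (f : ell2 R) r, l2_le f r -> l2_le (T f) (M * r).
Proof.
move=> lT M0; split=> [h f r hr|h].
  have r0 : 0 <= r by case: hr.
  have [rp|] := ltP 0 r; last first.
    move=> rn; have {rn} re : r = 0 by apply/eqP; rewrite eq_le rn r0.
    have -> : f = 0 *: f.
      apply: ell2_ext => n; rewrite ell2ZE mul0r.
      by apply: eq0_normc; apply/eqP; rewrite eq_le -{1}re l2_le_pt//= normc_ge0.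
    rewrite linZ// re mulr0.
    rewrite scale0r; exact: l2_le0.
  have [g [_ -> hg]] := l2_normalize lT hr rp.
  rewrite mulrC -[X in X * _](normc_real r0); apply: l2_leZ.
  apply/lnorm2_le => //; apply: le_trans h.
  apply: ereal_sup_ubound; exists g => //=.
  exact/lnorm2_le1.
apply: ge_ereal_sup => _ [f /= hf <-].
by apply/lnorm2_le => //; rewrite -[M]mulr1; apply: h; exact/lnorm2_le1.
Qed.

Lemma opnorm2_ge0 T : (0 <= opnorm 2%:E 2%:E T)%E.
Proof.
apply: (@le_trans _ _ (lnorm 2%:E (T 0))); first exact: poweR_ge0.
apply: ereal_sup_ubound; exists 0 => //=.
by apply/lnorm2_le1; exact: l2_le0.
Qed.

Lemma opexp_unique A U V : is_opexp A U -> is_opexp A V -> U = V.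
Proof.
have small W : is_opexp A W -> forall e : R, 0 < e -> \forall N \near \oo,
    forall g : ell2 R, l2_le g 1 -> l2_le (W g - exp_partial A N g) e.
  move=> [_ hW] e e0.
  have : \forall N \near \oo,
      (opnorm 2%:E 2%:E (fun phi => W phi - exp_partial A N phi)%R < e%:E)%E.
    by apply: (hW [set x | (x < e%:E)%E]); apply: open_nbhs_nbhs; split; [exact: open_ereal_lt_ereal|rewrite /= lte_fin].
  apply: filterS => N hN g hg; apply/lnorm2_le; first exact: ltW.
  apply: le_trans (ltW hN); apply: ereal_sup_ubound; exists g => //=.
  exact/lnorm2_le1.
move=> hU hV; have [[lU _] [lV _]] := (hU, hV).
have UV (g : ell2 R) : l2_le g 1 -> U g = V g.
  move=> hg; apply: ell2_ext => n; apply/eqP; rewrite -subr_eq0; apply/eqP.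
  apply: eq0_normc; apply/eqP; rewrite eq_le normc_ge0 andbT.
  apply/ler_addgt0Pr => e e0; rewrite add0r.
  have e2 : 0 < e / 2 by rewrite divr_gt0.
  have : \forall N \near \oo, normc (U g n - V g n) <= e.
    near=> N.
    have h1 : l2_le (U g - exp_partial A N g) (e / 2).
      by move: (g) hg; near: N; exact: small.
    have h2 : l2_le (V g - exp_partial A N g) (e / 2).
      by move: (g) hg; near: N; exact: small.
    have := l2_le_pt n (l2_leD h1 (l2_leZ (-1) h2)).
    rewrite !ell2DE !ell2NE normcN normc1 mul1r -splitr.
    by rewrite (_ : _ + _ = U g n - V g n)//; ring.
  by case/filter_ex.
apply/funext => f; have [r r0 hr] := ell2_bound f.
have [g [-> _ hg]] := l2_normalize lU hr r0.
by rewrite !linZ// UV.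
Unshelve. all: by end_near. Qed.

Section Existence.
Variables (A : ell2 R -> ell2 R) (M : R).
Hypotheses (lA : linear A) (M0 : 0 <= M).
Hypothesis AM : forall (f : ell2 R) r, l2_le f r -> l2_le (A f) (M * r).

Let v k (f : ell2 R) : ell2 R := (k`!%:R : R[i])^-1 *: iter k A f.

Let tail N : R := expR M - series (exp_coeff M) N.

Let v_le k (f : ell2 R) r : l2_le f r -> l2_le (v k f) (exp_coeff M k * r).
Proof.
move=> hr.
have h : l2_le (iter k A f) (M ^+ k * r).
  by elim: k => [|k IH] /=; rewrite ?expr0 ?mul1r// exprS -mulrA; exact: AM.
have kE : normc (k`!%:R^-1 : R[i]) = k`!%:R^-1.
  rewrite normcV (_ : (k`!%:R : R[i]) = (k`!%:R : R)%:C); last by rewrite rmorph_nat.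
  by rewrite normc_real ?ler0n.
have := l2_leZ (k`!%:R : R[i])^-1 h; rewrite kE.
rewrite (_ : _ * (_ * r) = exp_coeff M k * r)// /exp_coeff /=; ring.
Qed.

Let exp_partialE N f : exp_partial A N f = \sum_(k < N) v k f.
Proof. by []. Qed.

Let exp_partial_pt N f n : exp_partial A N f n = \sum_(k < N) v k f n.
Proof. exact: (ell2_sumE N (fun k => v k f) n). Qed.

Let exp_partial_diff N K (f : ell2 R) n :
  exp_partial A (N + K)%N f n - exp_partial A N f n = \sum_(k < K) v (N + k)%N f n.
Proof.
rewrite !exp_partial_pt big_split_ord /= addrAC subrr add0r.
by apply: eq_bigr.
Qed.

Let tail_ge N K : \sum_(k < K) exp_coeff M (N + k)%N <= tail N.
Proof.
rewrite lerBrDr.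
have -> : \sum_(k < K) exp_coeff M (N + k)%N + series (exp_coeff M) N
    = series (exp_coeff M) (N + K)%N.
  by rewrite /series /= !big_mkord big_split_ord /= addrC.
apply: nondecreasing_cvgn_le; last exact: is_cvg_series_exp_coeff.
by apply: nondecreasing_series => k _ _; exact: exp_coeff_ge0.
Qed.

Let diff_le N K (f : ell2 R) r : l2_le f r ->
  l2_le (fun n => exp_partial A (N + K)%N f n - exp_partial A N f n) (tail N * r).
Proof.
move=> hr; have r0 : 0 <= r by case: hr.
under eq_fun do rewrite exp_partial_diff.
apply: l2_leW (l2_le_sum K (fun k => v_le (N + k)%N hr)).
by rewrite -mulr_suml ler_wpM2r.
Qed.

Let cvg_part (re : R[i] -> R) (f : ell2 R) n :
  (forall x y, re (x + y) = re x + re y) -> re 0 = 0 ->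
  (forall x, `|re x| <= normc x) ->
  cvgn (fun N => re (exp_partial A N f n)).
Proof.
move=> reD re0 ren; have [r r0 hr] := ell2_bound f.
have -> : (fun N => re (exp_partial A N f n)) = series (fun k => re (v k f n)).
  apply/funext => N; rewrite exp_partial_pt /series /= big_mkord.
  exact: (big_morph re reD re0).
apply: normed_cvg.
apply: (@series_le_cvg _ _ (fun k => exp_coeff M k * r)).
- by move=> k /=.
- by move=> k; rewrite mulr_ge0 ?exp_coeff_ge0// ltW.
- by move=> k /=; rewrite (le_trans (ren _))// (l2_le_pt _ (v_le _ hr)).
have -> : series (fun k => exp_coeff M k * r) = (fun N => series (exp_coeff M) N * r).
  by apply/funext => N; rewrite /series /= mulr_suml.
by apply: is_cvgMl; exact: is_cvg_series_exp_coeff.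
Qed.

Let Re_le (x : R[i]) : `|complex.Re x| <= normc x.
Proof.
case: x => a b /=; rewrite -sqrtr_sqr ler_wsqrtr//.
by rewrite lerDl sqr_ge0.
Qed.

Let Im_le (x : R[i]) : `|complex.Im x| <= normc x.
Proof.
case: x => a b /=; rewrite -sqrtr_sqr ler_wsqrtr//.
by rewrite lerDr sqr_ge0.
Qed.

Let cvg_Re f n : cvgn (fun N => complex.Re (exp_partial A N f n)).
Proof. by apply: cvg_part => [[? ?] [? ?]||]. Qed.

Let cvg_Im f n : cvgn (fun N => complex.Im (exp_partial A N f n)).
Proof. by apply: cvg_part => [[? ?] [? ?]||]. Qed.

Let Ufun (f : ell2 R) (n : int) : R[i] :=
  limn (fun N => complex.Re (exp_partial A N f n)) +i*
  limn (fun N => complex.Im (exp_partial A N f n)).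

Let sqr_normc' (x : R[i]) :
  normc x ^+ 2 = complex.Re x ^+ 2 + complex.Im x ^+ 2.
Proof. by case: x => a b; rewrite /= sqr_sqrtr// addr_ge0 ?sqr_ge0. Qed.

Let Ufun_le N (f : ell2 R) r : l2_le f r ->
  l2_le (fun n => Ufun f n - exp_partial A N f n) (tail N * r).
Proof.
move=> hr; have r0 : 0 <= r by case: hr.
have t0 : 0 <= tail N by have := tail_ge N 0; rewrite big_ord0.
split; first exact: mulr_ge0.
move=> X.
have cv n : (fun K => normc (exp_partial A (N + K)%N f n - exp_partial A N f n) ^+ 2)
    @ \oo --> normc (Ufun f n - exp_partial A N f n) ^+ 2.
  rewrite sqr_normc'; under eq_fun do rewrite sqr_normc'.
  have sh (u : R^nat) : cvgn u -> (fun K => u (N + K)%N) @ \oo --> limn u.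
    move=> cu; have -> : (fun K => u (N + K)%N) = [sequence u (n + N)%N]_n.
      by apply/funext => K /=; rewrite addnC.
    by rewrite cvg_shiftn.
  have sqc (u : R^nat) (l : R) : u @ \oo --> l -> (fun K => u K ^+ 2) @ \oo --> l ^+ 2.
    by move=> ul; under eq_fun do rewrite expr2; rewrite expr2; exact: cvgM.
  have reB (x y : R[i]) : complex.Re (x - y) = complex.Re x - complex.Re y.
    by case: x; case: y.
  have imB (x y : R[i]) : complex.Im (x - y) = complex.Im x - complex.Im y.
    by case: x; case: y.
  apply: cvgD.
    rewrite reB; under eq_fun do rewrite reB.
    apply: sqc; apply: cvgB; last exact: cvg_cst.
    exact: (sh (fun N => complex.Re (exp_partial A N f n))).

  rewrite imB; under eq_fun do rewrite imB.
    apply: sqc; apply: cvgB; last exact: cvg_cst.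
    exact: (sh (fun N => complex.Im (exp_partial A N f n))).

have cvX : (fun K => \sum_(n <- X) normc (exp_partial A (N + K)%N f n - exp_partial A N f n) ^+ 2)
    @ \oo --> \sum_(n <- X) normc (Ufun f n - exp_partial A N f n) ^+ 2.
  elim: (enum_fset X) => [|n s IH].
    by under eq_fun do rewrite big_nil; rewrite big_nil; exact: cvg_cst.
  by under eq_fun do rewrite big_cons; rewrite big_cons; apply: cvgD.
apply: (@closed_cvg _ _ _ _ _ [set x | x <= (tail N * r) ^+ 2] _ _ _ cvX).
  exact: closed_le.
by apply: nearW => K /=; case: (diff_le N K hr).
Qed.

Let Ufun_subproof f : Ufun f \in @ell2_pred R.
Proof.
have [r r0 hr] := ell2_bound f; apply/ell2_predP; exists (tail 0 * r).
have := Ufun_le 0 hr.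
under eq_fun do rewrite exp_partialE big_ord0 ell20E subr0.
by [].
Qed.

Let Uop (f : ell2 R) : ell2 R := Ell2 (Ufun_subproof f).

Let tail_cvg0 : tail @ \oo --> 0.
Proof.
rewrite -(subrr (expR M)); apply: cvgB; first exact: cvg_cst.
exact: is_cvg_series_exp_coeff.
Qed.

Let iter_lin k : linear (iter k A).
Proof.
elim: k => [//|k IH] c f g /=.
by rewrite IH lA.
Qed.

Let exp_partial_lin N : linear (exp_partial A N).
Proof.
move=> c f g; rewrite !exp_partialE scaler_sumr -big_split /=.
apply: eq_bigr => k _; rewrite /v iter_lin scalerDr !scalerA.
by rewrite [c * _]mulrC.
Qed.

Let Uop_lin : linear Uop.
Proof.
move=> c f g.
have [r r0 hr] := ell2_bound f; have [s s0 hs] := ell2_bound g.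
have [q q0 hq] := ell2_bound (c *: f + g).
apply: ell2_ext => n; rewrite ell2DE ell2ZE.
apply/eqP; rewrite -subr_eq0; apply/eqP; apply: eq0_normc; apply/eqP.
rewrite eq_le normc_ge0 andbT.
have cv : (fun N => tail N * q + normc (- c) * (tail N * r)
            + normc (-1 : R[i]) * (tail N * s)) @ \oo --> (0 : R).
  have c0 (d : R) : (fun N => tail N * d) @ \oo --> (0 : R).
    by rewrite -(mul0r d); apply: cvgMl.
  have c1 (d e : R) : (fun N => e * (tail N * d)) @ \oo --> (0 : R).
    by rewrite -(mulr0 e); apply: cvgM; [exact: cvg_cst|exact: c0].
  have h := cvgD (cvgD (c0 q) (c1 r (normc (- c)))) (c1 s (normc (-1 : R[i]))).
  by move: h; rewrite !addr0 => h; apply: h.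
apply: (@closed_cvg _ _ _ _ _ [set x | normc (Uop (c *: f + g) n - (c * Uop f n + Uop g n)) <= x] _ _ _ cv).
  exact: closed_ge.
apply: nearW => N /=.
have := l2_le_pt n (l2_leD (l2_leD (Ufun_le N hq) (l2_leZ (- c) (Ufun_le N hr)))
                 (l2_leZ (-1) (Ufun_le N hs))).
congr (_ <= _); congr normc.
rewrite exp_partial_lin ell2DE ell2ZE; ring.
Qed.

Lemma opexp_exists : exists U, is_opexp A U.
Proof.
exists Uop; split; first exact: Uop_lin.
apply: (@squeeze_cvge _ _ _ _ (cst 0%E) _ (fun N => (tail N)%:E)).
- apply: nearW => N; rewrite opnorm2_ge0 /=.
  apply: ge_ereal_sup => _ [f /= /lnorm2_le1 hf <-].
  have t0 : 0 <= tail N by have := tail_ge N 0; rewrite big_ord0.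
  by apply/lnorm2_le => //; have := Ufun_le N hf; rewrite mulr1.
- exact: cvg_cst.
- by apply: cvg_EFin; [exact: nearW|exact: tail_cvg0].
Qed.

End Existence.

(* Hence opexp is meaningful on every bounded operator. *)
Lemma opexpP A : linear A -> (opnorm 2%:E 2%:E A < +oo)%E ->
  is_opexp A (opexp A).
Proof.
move=> lA hA; apply: (@xgetPex _ (fun=> 0) [set U | is_opexp A U]).
have Af : opnorm 2%:E 2%:E A \is a fin_num.
  by rewrite ge0_fin_numE ?opnorm2_ge0.
have M0 : 0 <= fine (opnorm 2%:E 2%:E A) by rewrite fine_ge0 ?opnorm2_ge0.
apply: (opexp_exists lA M0); apply/opnorm2_le => //.
by rewrite fineK.
Qed.

Lemma opnorm_laplacian : (opnorm 2%:E 2%:E (@laplacian R) <= 4%:E)%E.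
Proof.
apply/opnorm2_le => //; first exact: laplacian_linear.
by move=> f r; exact: l2_le_laplacian.
Qed.

End OpexpTheory.

(* The propagator exp(- i t Delta^2). *)
Definition propagator (R : realType) (t : R) : ell2 R -> ell2 R :=
  opexp (fun phi => (- ('i * t%:C)) *: laplacian (laplacian phi)).

Lemma propagatorP (R : realType) (t : R) :
  is_opexp (fun phi => (- ('i * t%:C)) *: laplacian (laplacian phi))
    (propagator t).
Proof.
set c := - _.
have lT : linear (fun phi : ell2 R => c *: laplacian (laplacian phi)).
  move=> d f g; rewrite !laplacian_linear scalerDr !scalerA.
  by rewrite [c * _]mulrC.
apply: opexpP => //.
have M0 : 0 <= normc c * (4 * 4) by rewrite mulr_ge0 ?normc_ge0.
apply: le_lt_trans (ltry (normc c * (4 * 4))).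
apply/opnorm2_le => // f r h; rewrite -!mulrA.
by apply: l2_leZ; do 2 apply: l2_le_laplacian.
Qed.

(* Main.v *)
(* The kernel of e^{-itD^2} is (1/pi) times the integral over [0, pi] of
   e^{-ith(x)} cos(jx), with symbol h(x) = (2 - 2 cos x)^2, and van der Corput's
   lemma bounds it: the fourth derivative of h is bounded away from 0 where
   cos x lies in [4/5, 1] (near the degenerate point x = 0) or in [-3/5, 0],
   and the second one on the rest of [0, pi].

   No integral is needed.  The truncated exponential series has trigonometric
   polynomials as symbols, whose primitives F are explicit; F' is uniformly
   close to the cosine of the phase, and van der Corput's lemma is proved as a
   bound on F b - F a which is stable under such a perturbation.  By finite
   speed of propagation a truncated series only sees finitely many values of
   the initial datum, so the kernel bound passes to l^1 -> l^oo. *)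
Require Import Defs.
From mathcomp Require Import all_boot all_order all_algebra finmap.
From mathcomp Require Import all_classical all_reals all_analysis.
From mathcomp Require Import complex.
From mathcomp Require Import ring lra zify.

Set Implicit Arguments.
Unset Strict Implicit.
Unset Printing Implicit Defensive.

Import Order.TTheory GRing.Theory Num.Theory.
Import numFieldNormedType.Exports.
Import Normc.
Local Open Scope classical_set_scope.
Local Open Scope ring_scope.

(** * Increments controlled by derivatives, and van der Corput's lemma *)

Lemma within_continuous_is_derive (R : realType) (f df : R -> R) (a b : R) :
  (forall x, a <= x <= b -> is_derive x 1 f (df x)) ->
  {within `[a, b], continuous f}.
Proof.
move=> df_; apply: derivable_within_continuous => x.
by rewrite in_itv/= => /df_ [].
Qed.

(** Mean value theorem for [g - s * f] with [s] equal to 1 or -1, whose derivative is nonnegative. A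
    dominating function [g], rather than a constant, lets the bound measure a total variation. *)
Lemma le_increment (R : realType) (f g df dg : R -> R) (a b : R) : a <= b ->
  (forall x, a <= x <= b -> is_derive x 1 f (df x)) ->
  (forall x, a <= x <= b -> is_derive x 1 g (dg x)) ->
  (forall x, a <= x <= b -> `|df x| <= dg x) ->
  `|f b - f a| <= g b - g a.
Proof.
move=> ab f' g' fg.
have mono (s : R) : `|s| = 1 -> s * (f b - f a) <= g b - g a.
  move=> s1.
  have d x : a <= x <= b ->
      is_derive x 1 (fun y => g y - s * f y) (dg x - s * df x).
    by move=> xab; have := f' x xab; have := g' x xab => *; apply: is_deriveB.
  have d' x : x \in `]a, b[ ->
      is_derive x 1 (fun y => g y - s * f y) (dg x - s * df x).
    by move=> /subset_itv_oo_cc; rewrite in_itv => /d.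
  have [c + e] := MVT_segment ab d' (within_continuous_is_derive d).
  rewrite in_itv => /fg fgc.
  have p : 0 <= dg c - s * df c.
    rewrite subr_ge0 (le_trans _ fgc)// (le_trans (ler_norm _))//.
    by rewrite normrM s1 mul1r.
  have ba : 0 <= b - a by rewrite subr_ge0.
  by have := mulr_ge0 p ba; rewrite -e; lra.
have := mono 1; have := mono (-1); rewrite normrN normr1 mulN1r mul1r ler_norml.
by move=> /(_ erefl) ? /(_ erefl) ?; lra.
Qed.

Lemma le_increment_lip (R : realType) (f df : R -> R) (a b M : R) : a <= b ->
  (forall x, a <= x <= b -> is_derive x 1 f (df x)) ->
  (forall x, a <= x <= b -> `|df x| <= M) ->
  `|f b - f a| <= M * (b - a).
Proof.
move=> ab f' fM; rewrite mulrBr.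
apply: (@le_increment _ f (fun x => M * x) df (cst M)) => // x _.
by rewrite /cst; apply: is_derive_eq; rewrite /GRing.scale/= mulr1.
Qed.

(* Integration by parts: [sin phi / phi'] is an approximate antiderivative of
   [cos phi], with an error controlled by the total variation of [1 / phi']. *)
Lemma van_der_corput1 (R : realType) (phi dphi ddphi F f : R -> R)
    (a b m e s : R) : a <= b -> 0 < m -> `|s| <= 1 ->
  (forall x, a <= x <= b -> is_derive x 1 phi (dphi x)) ->
  (forall x, a <= x <= b -> is_derive x 1 dphi (ddphi x)) ->
  (forall x, a <= x <= b -> is_derive x 1 F (f x)) ->
  (forall x, a <= x <= b -> `|f x - cos (phi x)| <= e) ->
  (forall x, a <= x <= b -> m <= dphi x) ->
  (forall x, a <= x <= b -> `|ddphi x| = s * ddphi x) ->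
  `|F b - F a| <= 3 / m + e * (b - a).
Proof.
move=> ab m0 s1 phi' dphi' F' fe dphi_m ddphi_s.
have dn0 x : a <= x <= b -> dphi x != 0.
  by move=> xab; rewrite gt_eqF// (lt_le_trans m0)// dphi_m.
have invm x : a <= x <= b -> 0 <= (dphi x)^-1 <= m^-1.
  move=> xab; have p := lt_le_trans m0 (dphi_m x xab).
  by rewrite invr_ge0 ltW//= lef_pV2// dphi_m.
pose S x := sin (phi x) * (dphi x)^-1.
have S_le x : a <= x <= b -> `|S x| <= m^-1.
  move=> xab; rewrite normrM; have /andP[i0 im] := invm x xab.
  rewrite (ger0_norm i0) (le_trans _ im)//.
  by rewrite ler_piMl// sin_max.
(* The derivative of [F - S] is [f - cos phi] plus [sin phi * phi'' / phi'^2]. As [s] carries the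
   sign of [phi''], the majorant [e + |phi''| / phi'^2] has the explicit primitive
   [e x - s / phi']. *)
have h : `|(F b - S b) - (F a - S a)| <=
    (e * b - s * (dphi b)^-1) - (e * a - s * (dphi a)^-1).
  apply: (@le_increment _ (fun x => F x - S x) (fun x => e * x - s * (dphi x)^-1)
    (fun x => f x - cos (phi x) + S x * (ddphi x * (dphi x)^-1))
    (fun x => e + `|ddphi x| * (dphi x) ^- 2) a b ab) => x xab.
  - have := phi' x xab; have := dphi' x xab; have := F' x xab => ? ? ?.
    have ? := is_deriveV (dn0 x xab) (dphi' x xab).
    have ? : is_derive x 1 (fun y => sin (phi y)) (cos (phi x) * dphi x).
      exact: (@is_derive1_comp _ (@sin R)).
    rewrite /S; apply: is_derive_eq; rewrite /GRing.scale/=; field; exact: dn0.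
  - have ? := is_deriveV (dn0 x xab) (dphi' x xab).
    rewrite ddphi_s//; apply: is_derive_eq; rewrite /GRing.scale/=; ring.
  - rewrite (le_trans (ler_normD _ _))// lerD ?fe//.
    have i0 : 0 <= (dphi x)^-1 by case/andP: (invm x xab).
    rewrite /S !normrM (ger0_norm i0).
    rewrite -exprVn -mulrA (mulrCA (dphi x)^-1) -expr2.
    by rewrite ler_piMl ?sin_max// mulr_ge0 ?sqr_ge0.
have aab : a <= a <= b by rewrite lexx.
have bab : a <= b <= b by rewrite lexx andbT.
have sab : `|s * ((dphi a)^-1 - (dphi b)^-1)| <= m^-1.
  rewrite normrM -[leRHS]mul1r ler_pM// ler_norml.
  have /andP[? ?] := invm a aab; have /andP[? ?] := invm b bab.
  by apply/andP; split; lra.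
have := S_le a aab; have := S_le b bab.
(* Two copies of [1 / m] come from [S] at the endpoints, the third from the variation of
   [1 / phi']. *)
have -> : 3 / m = m^-1 + (m^-1 + m^-1) by lra.
move: h sab; rewrite !ler_norml.
move=> /andP[? ?] /andP[? ?] /andP[? ?] /andP[? ?].
by apply/andP; split; lra.
Qed.

Lemma increment_ge (R : realType) (f df : R -> R) (a b m : R) : a <= b ->
  (forall x, a <= x <= b -> is_derive x 1 f (df x)) ->
  (forall x, a <= x <= b -> m <= df x) ->
  m * (b - a) <= f b - f a.
Proof.
move=> ab f' fm.
have h : `|cst 0 b - cst 0 a : R| <= (f b - m * b) - (f a - m * a).
  apply: (@le_increment _ (cst 0) (fun x => f x - m * x)
    (cst 0) (fun x => df x - m)) => // x xab.
  - have ? := f' x xab.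
    by apply: is_derive_eq; rewrite /GRing.scale/= mulr1.
  - by rewrite /cst normr0 subr_ge0 fm.
move: h; rewrite /cst subrr normr0; lra.
Qed.

(** The point [c] is a zero of [f] given by the intermediate value theorem. If [f] keeps a constant
    sign, an endpoint serves as [c], and one of the two implications is vacuous. *)
Lemma increasing_split (R : realType) (f df : R -> R) (a b m : R) : a <= b ->
  0 <= m ->
  (forall x, a <= x <= b -> is_derive x 1 f (df x)) ->
  (forall x, a <= x <= b -> m <= df x) ->
  exists2 c, a <= c <= b & forall x, a <= x <= b ->
    (x < c -> m * (c - x) <= - f x) /\ (c < x -> m * (x - c) <= f x).
Proof.
move=> ab m0 f' fm.
have inc x y : a <= x -> x <= y -> y <= b -> m * (y - x) <= f y - f x.
  move=> ax xy yb; apply: (increment_ge xy) => z /andP[xz zy].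
    by apply: f'; rewrite (le_trans ax)//= (le_trans zy).
  by apply: fm; rewrite (le_trans ax)//= (le_trans zy).
have [fa|fa] := leP 0 (f a).
  exists a; first by rewrite lexx.
  move=> x /andP[ax xb]; rewrite ltNge ax; split=> // _.
  by have := inc a x (lexx _) ax xb; lra.
have [fb|fb] := leP (f b) 0.
  exists b; first by rewrite lexx andbT.
  move=> x /andP[ax xb]; rewrite (ltNge b) xb; split=> // _.
  by have := inc x b ax xb (lexx _); lra.
have := @IVT _ f a b 0 ab (within_continuous_is_derive f').
rewrite ge_min (ltW fa) le_max (ltW fb) orbT => /(_ erefl)[c].
rewrite in_itv/= => /andP[ac cb] fc; exists c; first by rewrite ac.
move=> x /andP[ax xb]; split=> /ltW h.
  by have := inc x c ax h cb; rewrite fc; lra.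
by have := inc c x ac h xb; rewrite fc; lra.
Qed.

(* [psi] is at least [m] in absolute value outside an interval of length at
   most [2 / mu]. *)
Lemma increment_le_split (R : realType) (F f psi dpsi : R -> R)
    (a b mu m C e : R) : a <= b -> 0 < mu -> 0 <= m -> 0 <= C ->
  (forall x, a <= x <= b -> is_derive x 1 psi (dpsi x)) ->
  (forall x, a <= x <= b -> m * mu <= dpsi x) ->
  (forall x, a <= x <= b -> is_derive x 1 F (f x)) ->
  (forall x, a <= x <= b -> `|f x| <= 1 + e) ->
  (forall a' b', a <= a' -> a' <= b' -> b' <= b ->
    (forall x, a' <= x <= b' -> m <= psi x) \/
    (forall x, a' <= x <= b' -> m <= - psi x) ->
    `|F b' - F a'| <= C / mu + e * (b' - a')) ->
  `|F b - F a| <= (2 * C + 2) / mu + e * (b - a).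
Proof.
move=> ab mu0 m0 C0 psi' psim F' f1 ih.
have [c /andP[ac cb] hc] :=
  increasing_split ab (mulr_ge0 m0 (ltW mu0)) psi' psim.
have d0 : 0 < mu^-1 by rewrite invr_gt0.
have Cmu : 0 <= C / mu by rewrite divr_ge0// ltW.
have mmu y : mu^-1 <= y -> m <= m * mu * y.
  move=> dy; rewrite -mulrA ler_peMr// -(mulfV (lt0r_neq0 mu0)).
  by rewrite ler_pM2l.
have mmuP (x y : R) : (mu^-1 <= y - x) -> x < y.
  by move=> h; rewrite -subr_gt0; exact: lt_le_trans h.
(* The left piece stops at distance [1 / mu] before [c], or is empty if that point falls before [a];
   on it [psi <= - m]. The right piece is symmetric. *)
have [a1 [aa1 a1c a1l hl]] : exists a1, [/\ a <= a1, a1 <= c, c - mu^-1 <= a1 &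
    `|F a1 - F a| <= C / mu + e * (a1 - a)].
  have [h|h] := leP (c - mu^-1) a.
    by exists a; split => //; rewrite !subrr normr0 mulr0 addr0.
  exists (c - mu^-1); split=> //; first exact: ltW.
    by rewrite gerBl ltW.
  apply: ih; [by []|exact: ltW| |].
    by rewrite lerBlDr (le_trans cb)// lerDl ltW.
  right=> x /andP[ax xc].
  have dx : mu^-1 <= c - x by rewrite lerBrDr addrC -lerBrDr.
  apply: (le_trans (mmu _ dx)); apply: (hc x _).1; last exact: mmuP.
  by rewrite ax (le_trans (ltW (mmuP _ _ dx))).
have [b1 [bb1 b1c b1l hr]] : exists b1, [/\ b1 <= b, c <= b1, b1 <= c + mu^-1 &
    `|F b - F b1| <= C / mu + e * (b - b1)].
  have [h|h] := leP b (c + mu^-1).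
    by exists b; split => //; rewrite !subrr normr0 mulr0 addr0.
  exists (c + mu^-1); split=> //; first exact: ltW.
    by rewrite lerDl ltW.
  apply: ih; [|exact: ltW|by []|].
    by rewrite (le_trans ac)// lerDl ltW.
  left=> x /andP[cx xb].
  have dx : mu^-1 <= x - c by rewrite lerBrDr addrC.
  apply: (le_trans (mmu _ dx)); apply: (hc x _).2; last exact: mmuP.
  by rewrite xb (le_trans ac)// (ltW (mmuP _ _ dx)).
have a1b1 : a1 <= b1 by exact: le_trans b1c.
(* The middle piece has length at most [2 / mu], and there the trivial bound on [f] suffices: this
   is the summand 2 of the constant. *)
have hm : `|F b1 - F a1| <= (1 + e) * (b1 - a1).
  apply: (le_increment_lip a1b1) => x /andP[ax xb].
    by apply: F'; rewrite (le_trans aa1)//= (le_trans xb).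
  by apply: f1; rewrite (le_trans aa1)//= (le_trans xb).
have -> : (2 * C + 2) / mu = C / mu + C / mu + 2 * mu^-1 by ring.
move: hl hr hm; rewrite !ler_norml.
move=> /andP[? ?] /andP[? ?] /andP[? ?].
by apply/andP; split; lra.
Qed.

(** The recurrence is that of [increment_le_split]; the initial value is [2 * 3 + 2], with the 3 of
    [van_der_corput1]. The index [k] stands for a derivative of order [k.+2]. *)
Fixpoint vdc_const (R : realType) (k : nat) : R :=
  if k is k'.+1 then 2 * vdc_const R k' + 2 else 8.

Lemma vdc_const_ge0 (R : realType) k : 0 <= vdc_const R k.
Proof. by elim: k => //= k ih; rewrite addr_ge0// mulr_ge0. Qed.

(** Induction on the order: a lower bound [mu ^+ k.+3] on one derivative makes the previous one at
    least [mu ^+ k.+2] in absolute value off a short interval. Where it is negative, the phase is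
    replaced by its opposite, [cos] being even. Lower bounds written as powers of [mu] give the same
    rate [1 / mu] at every order. *)
Lemma van_der_corput (R : realType) (k : nat) (phi : nat -> R -> R)
    (F f : R -> R) (a b mu e : R) : a <= b -> 0 < mu ->
  (forall i (x : R), is_derive x 1 (phi i) (phi i.+1 x)) ->
  (forall x, a <= x <= b -> is_derive x 1 F (f x)) ->
  (forall x, a <= x <= b -> `|f x - cos (phi 0%N x)| <= e) ->
  (forall x, a <= x <= b -> mu ^+ k.+2 <= phi k.+2 x) ->
  `|F b - F a| <= vdc_const R k / mu + e * (b - a).
Proof.
move=> + mu0; elim: k phi a b => [|k ih] phi a b ab phi' F' fe phik.
all: have f1 x : a <= x <= b -> `|f x| <= 1 + e
  by move=> xab; rewrite -(subrK (cos (phi 0%N x)) (f x)) addrC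
    (le_trans (ler_normD _ _))// lerD ?cos_max ?fe.
  have -> : vdc_const R 0 = 2 * 3 + 2 by rewrite /=; lra.
  have sqr_mu : 0 <= mu ^+ 2 by exact: sqr_ge0.
  apply: (@increment_le_split _ F f (phi 1%N) (phi 2%N) a b mu mu) => //.
  - exact: ltW.
  - move=> a' b' aa' ab' bb' h.
    have sub x : a' <= x <= b' -> a <= x <= b.
      by move=> /andP[ax xb]; rewrite (le_trans aa')//= (le_trans xb).
    case: h => h.
      apply: (@van_der_corput1 _ (phi 0%N) (phi 1%N) (phi 2%N) F f _ _ mu e 1)
        => //.
      + by rewrite normr1.
      + by move=> x /sub/F'.
      + by move=> x /sub/fe.
      + by move=> x /sub/phik ?; rewrite mul1r ger0_norm// (le_trans sqr_mu).
    apply: (@van_der_corput1 _ (fun x => - phi 0%N x) (fun x => - phi 1%N x)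
      (fun x => - phi 2%N x) F f _ _ mu e (-1)) => //.
    + by rewrite normrN normr1.
    + by move=> x /sub/F'.
    + by move=> x /sub/fe; rewrite cosN.
    + move=> x /sub/phik ?.
      by rewrite mulN1r opprK normrN ger0_norm// (le_trans sqr_mu).
apply: (@increment_le_split _ F f (phi k.+2) (phi k.+3) a b mu (mu ^+ k.+2)) => //.
- exact/exprn_ge0/ltW.
- exact: vdc_const_ge0.
- by move=> x xab; rewrite -exprSr; exact: phik.
- move=> a' b' aa' ab' bb' h.
  have sub x : a' <= x <= b' -> a <= x <= b.
    by move=> /andP[ax xb]; rewrite (le_trans aa')//= (le_trans xb).
  case: h => h.
    by apply: (ih phi) => // [x /sub/F'|x /sub/fe].
  apply: (ih (fun i x => - phi i x)) => //.
  + by move=> x /sub/F'.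
  + by move=> x /sub/fe; rewrite cosN.
Qed.

(** * Derivatives of the phase and the partition of [0, pi] *)

(** Differentiation written as a shift by [pi / 2] gives the derivatives of all orders one closed
    form. *)
Lemma is_derive_cos_shift (R : realType) (c d x : R) :
  is_derive x 1 (fun y => cos (c * y + d)) (c * cos (c * x + (d + pi / 2))).
Proof.
have h : is_derive x 1 (fun y : R => c * y + d) c.
  by apply: is_derive_eq; rewrite /GRing.scale/= mulr1 addr0.
rewrite addrA cosDpihalf mulrC.
exact: (@is_derive1_comp _ (@cos R) _ x _ _ (is_derive_cos _) h).
Qed.

(* [6 + symbol 0] is the symbol of the square of the discrete Laplacian (see
   [symbol0E]), and [symbol i] is its [i]-th derivative for [i > 0]. *)
Definition symbol (R : realType) (i : nat) (x : R) : R :=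
  2 * 2 ^+ i * cos (2 * x + (pi / 2) *+ i) - 8 * cos (1 * x + (pi / 2) *+ i).

Lemma is_derive_symbol (R : realType) (i : nat) (x : R) :
  is_derive x 1 (symbol i) (symbol i.+1 x).
Proof.
have h1 := is_derive_cos_shift 1 ((pi / 2) *+ i) x.
have h2 := is_derive_cos_shift 2 ((pi / 2) *+ i) x.
rewrite /symbol; apply: is_derive_eq.
by rewrite /GRing.scale/= !mulrSr exprS; ring.
Qed.

Lemma symbol0E (R : realType) (x : R) :
  6 + symbol 0 x = (2 - 2 * cos x) ^+ 2.
Proof.
rewrite /symbol !mulr0n !addr0 mul1r (mulr_natl x) cos_mulr2n; ring.
Qed.

(** The factors show the degenerate points: [cos x = 1] and [cos x = - 1 / 2]. Near these the fourth
    derivative takes over. *)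
Lemma symbol2E (R : realType) (x : R) :
  symbol 2 x = 8 * ((1 - cos x) * (1 + 2 * cos x)).
Proof.
rewrite /symbol (_ : pi / 2 *+ 2 = pi); last exact/esym/splitr.
rewrite mul1r !cosDpi (mulr_natl x) cos_mulr2n; ring.
Qed.

Lemma symbol4E (R : realType) (x : R) :
  symbol 4 x = 64 * cos x ^+ 2 - 8 * cos x - 32.
Proof.
rewrite /symbol (mulrnA _ 2 2) (_ : pi / 2 *+ 2 = pi :> R); last exact/esym/splitr.
by rewrite !cosD2pi mul1r (mulr_natl x) cos_mulr2n; ring.
Qed.

(** An affine function and its successive derivatives. They vanish from order 2 on, which makes the
    bounds uniform in the frequency [xi]. *)
Definition affine_jet (R : realType) (xi th : R) (i : nat) (x : R) : R :=
  match i with 0%N => xi * x + th | 1%N => xi | _ => 0 end.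

Lemma is_derive_affine_jet (R : realType) (xi th : R) i (x : R) :
  is_derive x 1 (affine_jet xi th i) (affine_jet xi th i.+1 x).
Proof.
case: i => [|[|i]]; rewrite /affine_jet; apply: is_derive_eq => //.
by rewrite /GRing.scale/= mulr1 addr0.
Qed.

(** Since [cos] is even, the phase may be multiplied by the sign [s]; its derivative of order [k.+2]
    is then at least [t], hence at least [mu ^+ k.+2]. *)
Lemma increment_phase (R : realType) (k : nat) (t xi th a b mu s e : R)
    (F f : R -> R) : a <= b -> 0 < mu -> `|s| = 1 ->
  mu ^+ k.+2 <= t ->
  (forall x, a <= x <= b -> 1 <= s * symbol k.+2 x) ->
  (forall x, a <= x <= b -> is_derive x 1 F (f x)) ->
  (forall x, a <= x <= b -> `|f x - cos (t * symbol 0 x + xi * x + th)| <= e) ->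
  `|F b - F a| <= vdc_const R k / mu + e * (b - a).
Proof.
move=> ab mu0 s1 mut hs F' fe.
have t0 : 0 < t by rewrite (lt_le_trans _ mut)// exprn_gt0.
have cs x : cos (s * x) = cos x.
  have [->|->] : s = 1 \/ s = -1.
    by move: s1; case: (ger0P s) => _ <-; [left|right; rewrite opprK].
  by rewrite mul1r. by rewrite mulN1r cosN.
pose phi i x := s * (t * symbol i x + affine_jet xi th i x).
have phi' i (x : R) : is_derive x 1 (phi i) (phi i.+1 x).
  have ? := is_derive_symbol i x; have ? := is_derive_affine_jet xi th i x.
  by rewrite /phi; apply: is_derive_eq.
apply: (@van_der_corput R k phi F f a b mu e ab mu0 phi' F') => x xab.
  by rewrite /phi cs /affine_jet addrA; exact: fe.
apply: (le_trans mut).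
rewrite /phi /affine_jet addr0 mulrCA -[leLHS]mulr1 ler_pM2l//; exact: hs.
Qed.

(** The cut points are the arccosines of 4/5, 0 and -3/5, ordered because [cos] decreases on
    [0, pi]. On each piece the second or the fourth derivative of the symbol has modulus at least
    1. *)
Lemma cos_partition (R : realType) : exists x1 x2 x3 : R,
  [/\ 0 <= x1, x1 <= x2, x2 <= x3, x3 <= pi &
  [/\ forall x, 0 <= x <= x1 -> 4 / 5 <= cos x <= 1,
      forall x, x1 <= x <= x2 -> 0 <= cos x <= 4 / 5,
      forall x, x2 <= x <= x3 -> - (3 / 5) <= cos x <= 0 &
      forall x, x3 <= x <= pi -> - 1 <= cos x <= - (3 / 5)]].
Proof.
have r1 : -1 <= (4 / 5 : R) <= 1 by lra.
have r2 : -1 <= (0 : R) <= 1 by lra.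
have r3 : -1 <= (- (3 / 5) : R) <= 1 by lra.
have [/andP[a1 b1] c1] := acos_def r1.
have [/andP[a2 b2] c2] := acos_def r2.
have [/andP[a3 b3] c3] := acos_def r3.
have dec (x y : R) : 0 <= x -> x <= y -> y <= pi -> cos y <= cos x.
  move=> x0 xy ypi; rewrite leNgt ltr_cos ?in_itv/= -?leNgt//.
    by rewrite ypi andbT (le_trans x0).
  by rewrite x0 (le_trans xy).
have inc (x y : R) : 0 <= x <= pi -> 0 <= y <= pi -> cos y < cos x -> x <= y.
  by move=> x0 y0; rewrite ltr_cos ?in_itv//; exact: ltW.
have h12 : acos (4 / 5) <= (acos 0 : R).
  by apply: inc; rewrite ?a1 ?a2// c1 c2; lra.
have h23 : (acos 0 : R) <= acos (- (3 / 5)).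
  by apply: inc; rewrite ?a2 ?a3// c2 c3; lra.
exists (acos (4 / 5)), (acos 0), (acos (- (3 / 5))); split => //.
split=> x /andP[ax xb].
- by rewrite -{1}c1 dec ?cos_le1// (le_trans xb).
- by rewrite -{1}c2 -c1 !dec// ?(le_trans xb)// (le_trans a1).
- by rewrite -{1}c3 -c2 !dec// ?(le_trans xb)// (le_trans a2).
- by rewrite cos_geN1 -{1}c3 !dec.
Qed.

(** The pieces of order four and those of order two obey the same bound in [1 / mu], because
    [1 <= mu] gives [mu ^+ 2 <= mu ^+ 4 <= t]. *)
Lemma increment_phase_pi (R : realType) : exists2 C : R, 0 < C &
  forall (t xi th mu e : R) (F f : R -> R), 1 <= mu -> mu ^+ 4 <= t ->
  (forall x, 0 <= x <= pi -> is_derive x 1 F (f x)) ->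
  (forall x, 0 <= x <= pi -> `|f x - cos (t * symbol 0 x + xi * x + th)| <= e) ->
  `|F pi - F 0| <= C / mu + e * pi.
Proof.
exists (2 * vdc_const R 2 + 2 * vdc_const R 0).
  by rewrite /=; lra.
move=> t xi th mu e F f mu1 mut F' fe.
have mu0 : 0 < mu by exact: lt_le_trans mu1.
have mut2 : mu ^+ 2 <= t.
  by rewrite (le_trans _ mut)// ler_weXn2l.
have [x1 [x2 [x3 [x01 x12 x23 x3p [h1 h2 h3 h4]]]]] := cos_partition R.
have bound k s a b : 0 <= a -> a <= b -> b <= pi -> `|s| = 1 ->
    mu ^+ k.+2 <= t ->
    (forall x, a <= x <= b -> 1 <= s * symbol k.+2 x) ->
    `|F b - F a| <= vdc_const R k / mu + e * (b - a).
  move=> a0 ab bp s1 mk hs.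
  have sub x : a <= x <= b -> 0 <= x <= pi.
    by move=> /andP[ax xb]; rewrite (le_trans a0)//= (le_trans xb).
  apply: (increment_phase ab mu0 s1 mk hs) => x /sub; first exact: F'.
  exact: fe.
have x02 := le_trans x01 x12; have x03 := le_trans x02 x23.
have x2p := le_trans x23 x3p; have x1p := le_trans x12 x2p.
have m1 : `|-1 : R| = 1 by rewrite normrN normr1.
have : `|F x1 - F 0| <= vdc_const R 2 / mu + e * (x1 - 0).
  apply: (bound 2%N 1) => //; first by rewrite normr1.
  by move=> x /h1 /andP[? ?]; rewrite symbol4E; nra.
have : `|F x2 - F x1| <= vdc_const R 0 / mu + e * (x2 - x1).
  apply: (bound 0%N 1) => //; first by rewrite normr1.
  by move=> x /h2 /andP[? ?]; rewrite symbol2E; nra.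
have : `|F x3 - F x2| <= vdc_const R 2 / mu + e * (x3 - x2).
  apply: (bound 2%N (-1)) => //.
  by move=> x /h3 /andP[? ?]; rewrite symbol4E; nra.
have : `|F pi - F x3| <= vdc_const R 0 / mu + e * (pi - x3).
  apply: (bound 0%N (-1)) => //.
  by move=> x /h4 /andP[? ?]; rewrite symbol2E; nra.
rewrite !ler_norml => /andP[? ?] /andP[? ?] /andP[? ?] /andP[? ?].
have -> : (2 * vdc_const R 2 + 2 * vdc_const R 0) / mu =
  vdc_const R 2 / mu + vdc_const R 2 / mu + vdc_const R 0 / mu +
  vdc_const R 0 / mu by ring.
by apply/andP; split; lra.
Qed.

Lemma increment_bilaplacian_phase (R : realType) : exists2 C : R, 0 < C &
  forall (t xi th e : R) (F f : R -> R), 0 < t ->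
  (forall x, 0 <= x <= pi -> is_derive x 1 F (f x)) ->
  (forall x, 0 <= x <= pi ->
    `|f x - cos (t * (2 - 2 * cos x) ^+ 2 + xi * x + th)| <= e) ->
  `|F pi - F 0| <= C * t `^ (- 4^-1) + e * pi.
Proof.
have [C C0 hC] := increment_phase_pi R.
exists (C + pi); first by rewrite addr_gt0 ?pi_gt0.
move=> t xi th e F f t0 F' fe.
have mu0 : 0 < t `^ 4^-1 by exact: powR_gt0.
have mu4 : (t `^ 4^-1) ^+ 4 = t.
  by rewrite -powR_mulrn ?ltW// -powRrM mulVf// powRr1 ?ltW.
rewrite powRN mulrDl.
have pi_mu : 0 <= pi / t `^ 4^-1 by rewrite divr_ge0 ?pi_ge0 ?ltW.
have C_mu : 0 <= C / t `^ 4^-1 by rewrite divr_ge0 ?ltW.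
have [t1|t1] := leP 1 t.
  (* For [1 <= t], take [mu] to be the fourth root of [t]; the constant 6 in [symbol0E] is absorbed
     into the phase [th]. *)
  rewrite -addrA (le_trans (hC t xi (th + 6 * t) (t `^ 4^-1) e F f _ _ _ _))//.
  - by rewrite -[leLHS](powRr0 t) ler_powR.
  - by rewrite mu4.
  - move=> x /fe; rewrite -symbol0E.
    by have -> : t * (6 + symbol 0 x) + xi * x + th =
      t * symbol 0 x + xi * x + (th + 6 * t) by ring.
  - by rewrite lerD2l lerDr.
(* For [t < 1] the trivial bound is enough, as [t] to the power -1/4 is then at least 1; this
   accounts for the summand [pi] of the constant. *)
have : `|F pi - F 0| <= (1 + e) * (pi - 0).
  apply: (le_increment_lip (pi_ge0 R) F') => x xpi.
  rewrite -(subrK (cos (t * (2 - 2 * cos x) ^+ 2 + xi * x + th)) (f x)) addrC.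
  by rewrite (le_trans (ler_normD _ _))// lerD ?cos_max ?fe.
move=> /le_trans; apply.
have : pi <= pi / t `^ 4^-1.
  rewrite ler_peMr ?pi_ge0// -[leLHS]invr1 lef_pV2 ?posrE//.
  have : t `^ 4^-1 <= 1 `^ 4^-1.
    by rewrite ge0_ler_powR ?nnegrE ?invr_ge0 ?ltW.
  by rewrite powR1.
lra.
Qed.

(** * The bilaplacian on arbitrary sequences and its action on trigonometric ones *)

(** No summability is asked and the ring is arbitrary, so that the operator applies both to real
    cosine waves and to complex elements of l^2(Z). *)
Definition lap (A : pzRingType) (u : int -> A) (n : int) : A :=
  u (n + 1) + u (n - 1) - 2 * u n.

Definition lap2 (A : pzRingType) (k : nat) (u : int -> A) : int -> A :=
  iter k (fun v => lap (lap v)) u.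

Lemma lap2S (A : pzRingType) k (u : int -> A) :
  lap2 k.+1 u = lap (lap (lap2 k u)).
Proof. by []. Qed.

Lemma lap2_shift (A : pzRingType) k (u : int -> A) (m n : int) :
  lap2 k (fun j => u (j - m)) n = lap2 k u (n - m).
Proof.
elim: k n => // k ih n; rewrite !lap2S /lap !ih.
by rewrite ![_ + _ - m]addrAC.
Qed.

Lemma lap2_rmorph (A B : pzRingType) (f : {rmorphism A -> B}) k
    (u : int -> A) (n : int) :
  lap2 k (fun j => f (u j)) n = f (lap2 k u n).
Proof.
elim: k n => // k ih n; rewrite !lap2S /lap !ih.
by rewrite !(rmorphD, rmorphN, rmorphM, rmorph_nat).
Qed.

Lemma lap2_lin (A : comPzRingType) k (c d : A) (u v : int -> A) (n : int) :
  lap2 k (fun j => c * u j + d * v j) n = c * lap2 k u n + d * lap2 k v n.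
Proof.
elim: k n => // k ih n; rewrite !lap2S /lap !ih; ring.
Qed.

(** Finite speed of propagation: each bilaplacian reaches two sites further. *)
Lemma lap2_local (A : pzRingType) k (u v : int -> A) (n : int) :
  (forall m, `|m - n| <= k.*2%:Z -> u m = v m) -> lap2 k u n = lap2 k v n.
Proof.
elim: k n => [|k ih] n uv; first by apply: uv; rewrite subrr.
have e d : `|d| <= 2 -> lap2 k u (n + d) = lap2 k v (n + d).
  by move=> d2; apply: ih => m mn; apply: uv; lia.
have e0 := e 0; rewrite addr0 in e0.
rewrite !lap2S /lap -!addrA !e// ?e0//.
Qed.

(** Cosine waves are eigenfunctions since [cos (y + x) + cos (y - x) = 2 cos x cos y]. The shift [d]
    covers sine waves too. *)
Lemma lap_cos (R : realType) (x d : R) (n : int) :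
  lap (fun j => cos (j%:~R * x + d)) n =
  - (2 - 2 * cos x) * cos (n%:~R * x + d).
Proof.
rewrite /lap !intrD.
have -> : (n%:~R + 1) * x + d = (n%:~R * x + d) + x by ring.
have -> : (n%:~R + (-1)%:~R) * x + d = (n%:~R * x + d) - x by ring.
rewrite cosB cosD; ring.
Qed.

Lemma lap2_cos (R : realType) k (x d : R) (n : int) :
  lap2 k (fun j => cos (j%:~R * x + d)) n =
  (2 - 2 * cos x) ^+ 2 ^+ k * cos (n%:~R * x + d).
Proof.
elim: k n => [|k ih] n; first by rewrite expr0 mul1r.
rewrite lap2S exprS.
have lapM (c : R) u j : lap (fun i => c * u i) j = c * lap u j.
  by rewrite /lap; ring.
have -> : lap2 k (fun j => cos (j%:~R * x + d)) =
  (fun j => (2 - 2 * cos x) ^+ 2 ^+ k * cos (j%:~R * x + d)) by exact/funext.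
have -> : lap (fun j => (2 - 2 * cos x) ^+ 2 ^+ k * cos (j%:~R * x + d)) =
  (fun j => (2 - 2 * cos x) ^+ 2 ^+ k * - (2 - 2 * cos x) * cos (j%:~R * x + d)).
  by apply/funext => j; rewrite lapM lap_cos mulrA.
by rewrite lapM lap_cos; ring.
Qed.

Lemma lap2_sin (R : realType) k (x : R) (n : int) :
  lap2 k (fun j => sin (j%:~R * x)) n =
  (2 - 2 * cos x) ^+ 2 ^+ k * sin (n%:~R * x).
Proof.
have s j : sin (j%:~R * x) = cos (j%:~R * x + - (pi / 2)).
  by rewrite cosBpihalf.
rewrite s -lap2_cos; congr lap2; exact/funext.
Qed.

Lemma is_derive_lap2 (R : realType) k (u : R -> int -> R) (v : int -> R)
    (x : R) (n : int) :
  (forall j, is_derive x 1 (u ^~ j) (v j)) ->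
  is_derive x 1 (fun y => lap2 k (u y) n) (lap2 k v n).
Proof.
move=> u'; elim: k n => [|k ih] n; first exact: u'.
have lap' (w : R -> int -> R) z j : (forall j, is_derive x 1 (w ^~ j) (z j)) ->
    is_derive x 1 (fun y => lap (w y) j) (lap z j).
  by move=> w'; rewrite /lap; apply: is_deriveB.
by apply: (lap' (fun y => lap (lap2 k (u y)))) => j; apply: lap'.
Qed.

(** Applying [lap2 k] in the variable [j] turns these into primitives in [x] of
    [(2 - 2 cos x)^(2k) cos (j x)]. Frequency 0 is separate because of the division by [j]. *)
Definition cos_prim (R : realType) (x : R) (j : int) : R :=
  if j == 0 then x else sin (j%:~R * x) / j%:~R.

Definition sin_prim (R : realType) (x : R) (j : int) : R :=
  if j == 0 then 0 else - cos (j%:~R * x) / j%:~R.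

Lemma is_derive_mull (R : realType) (c x : R) : is_derive x 1 (fun y => c * y) c.
Proof. by apply: is_derive_eq; rewrite /GRing.scale/= mulr1. Qed.

Lemma is_derive_cos_prim (R : realType) (x : R) (j : int) :
  is_derive x 1 (fun y => cos_prim y j) (cos (j%:~R * x)).
Proof.
rewrite /cos_prim; have [->|j0] := eqVneq j 0.
  by rewrite mul0r cos0; exact: is_derive_id.
have jR : j%:~R != 0 :> R by rewrite intr_eq0.
have ? : is_derive x 1 (fun y => sin (j%:~R * y)) (cos (j%:~R * x) * j%:~R).
  exact: (@is_derive1_comp _ (@sin R) _ x _ _ _ (is_derive_mull _ x)).
by apply: is_derive_eq; rewrite /GRing.scale/=; field.
Qed.

Lemma is_derive_sin_prim (R : realType) (x : R) (j : int) :
  is_derive x 1 (fun y => sin_prim y j) (sin (j%:~R * x)).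
Proof.
rewrite /sin_prim; have [->|j0] := eqVneq j 0.
  by rewrite mul0r sin0; exact: is_derive_cst.
have jR : j%:~R != 0 :> R by rewrite intr_eq0.
have ? : is_derive x 1 (fun y => cos (j%:~R * y)) (- sin (j%:~R * x) * j%:~R).
  exact: (@is_derive1_comp _ (@cos R) _ x _ _ _ (is_derive_mull _ x)).
by apply: is_derive_eq; rewrite /GRing.scale/=; field.
Qed.

Lemma sin_intr_pi (R : realType) (j : int) : sin (j%:~R * pi) = 0 :> R.
Proof.
elim: j => [|n ih|n ih]; first by rewrite mul0r sin0.
  by rewrite -addn1 PoszD intrD mulrDl mul1r sinDpi ih oppr0.
rewrite -[LHS]opprK -sinDpi -[X in _ + X]mul1r -mulrDl.
have -> : (- (n.+1)%:Z)%:~R + 1 = (- n%:Z)%:~R :> R.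
  by rewrite -addn1 PoszD opprD intrD subrK.
by rewrite ih oppr0.
Qed.

(* The left-hand side is the integral of [(2 - 2 cos x)^(2k) cos (j x)] over
   [0, pi], computed from a primitive. *)
Lemma lap2_dirac (R : realType) k (j : int) :
  lap2 k (cos_prim pi) j - lap2 k (cos_prim 0) j =
  pi * lap2 k (fun i => (i == 0)%:R) j :> R.
Proof.
have := lap2_lin k 1 (-1) (cos_prim (pi : R)) (cos_prim 0) j.
rewrite mul1r mulN1r => <-.
have := lap2_lin k pi 0 (fun i => (i == 0)%:R : R) (fun=> 0) j.
rewrite !mul0r addr0 => <-; congr lap2; apply/funext => i.
(* Before [lap2 k] is applied, only frequency 0 contributes, as [sin (i pi) = 0] for every integer
   [i]. *)
rewrite addr0 mul1r mulN1r /cos_prim; case: eqVneq => _.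
  by rewrite subr0 mulr1.
by rewrite sin_intr_pi !mulr0 sin0 mul0r subr0.
Qed.

(** * Remainders of the exponential, cosine and sine series *)

Definition exp_tail (R : realType) (M : R) (N : nat) : R :=
  expR M - series (exp_coeff M) N.

Lemma exp_tail_cvg0 (R : realType) (M : R) : exp_tail M @ \oo --> 0.
Proof.
rewrite -(subrr (expR M)); apply: cvgB; first exact: cvg_cst.
exact: is_cvg_series_exp_coeff.
Qed.

(** The terms between [N] and [n] are dominated by those of the exponential series; then [n] tends
    to infinity. *)
Lemma series_dist_le_exp_tail (R : realType) (u : R^nat) (l M : R) (N : nat) :
  (forall k, `|u k| <= exp_coeff M k) -> series u @ \oo --> l ->
  `|series u N - l| <= exp_tail M N.
Proof.
move=> uM ul.
have cu : (fun n => `|series u N - series u n|) @ \oo --> `|series u N - l|.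
  by apply: cvg_norm; apply: cvgB => //; exact: cvg_cst.
have ce : (fun n => series (exp_coeff M) n - series (exp_coeff M) N) @ \oo -->
    exp_tail M N.
  by apply: cvgB; [exact: is_cvg_series_exp_coeff|exact: cvg_cst].
apply: (ler_cvg_to cu ce); near=> n.
have Nn : (N <= n)%N by near: n; exact: nbhs_infty_ge.
rewrite distrC !sub_series_geq// (le_trans (ler_norm_sum _ _ _))//.
by apply: ler_sum => k _; exact: uM.
Unshelve. all: by end_near. Qed.

Lemma cos_coeffM (R : realType) (t y : R) k :
  cos_coeff (t * y) k = cos_coeff t k * y ^+ k.
Proof. by rewrite /cos_coeff /= exprMn; ring. Qed.

Lemma sin_coeffM (R : realType) (t y : R) k :
  sin_coeff (t * y) k = sin_coeff t k * y ^+ k.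
Proof. by rewrite /sin_coeff /= exprMn; ring. Qed.

Lemma cos_coeff_le (R : realType) (y M : R) k : `|y| <= M ->
  `|cos_coeff y k| <= exp_coeff M k.
Proof.
move=> yM; have M0 := le_trans (normr_ge0 y) yM.
rewrite /cos_coeff /exp_coeff /= !normrM normr_sign mulr1 normrX.
rewrite normfV !normr_nat ler_wpM2r ?invr_ge0//.
rewrite (@le_trans _ _ (`|y| ^+ k))//.
  by rewrite ler_piMl ?exprn_ge0//; case: (odd k).
by apply: lerXn2r; rewrite ?nnegrE.
Qed.

Lemma sin_coeff_le (R : realType) (y M : R) k : `|y| <= M ->
  `|sin_coeff y k| <= exp_coeff M k.
Proof.
move=> yM; have M0 := le_trans (normr_ge0 y) yM.
rewrite /sin_coeff /exp_coeff /= !normrM normrX normrN normr1 expr1n mulr1.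
rewrite normrX normfV !normr_nat ler_wpM2r ?invr_ge0//.
rewrite (@le_trans _ _ (`|y| ^+ k))//.
  by rewrite ler_piMl ?exprn_ge0//; case: (odd k).
by apply: lerXn2r; rewrite ?nnegrE.
Qed.

Lemma series_cos_coeff_dist (R : realType) (y M : R) N : `|y| <= M ->
  `|series (cos_coeff y) N - cos y| <= exp_tail M N.
Proof.
move=> yM; apply: series_dist_le_exp_tail => [k|]; first exact: cos_coeff_le.
by rewrite unlock; exact: is_cvg_series_cos_coeff.
Qed.

Lemma series_sin_coeff_dist (R : realType) (y M : R) N : `|y| <= M ->
  `|series (sin_coeff y) N - sin y| <= exp_tail M N.
Proof.
move=> yM; apply: series_dist_le_exp_tail => [k|]; first exact: sin_coeff_le.
by rewrite unlock; exact: is_cvg_series_sin_coeff.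
Qed.

Lemma is_derive_sum_fun (R : realType) N (g : nat -> R -> R) (dg : nat -> R)
    (x : R) :
  (forall k, is_derive x 1 (g k) (dg k)) ->
  is_derive x 1 (fun y => \sum_(k < N) g k y) (\sum_(k < N) dg k).
Proof.
move=> g'; have -> : (fun y => \sum_(k < N) g k y) = \sum_(k < N) g k.
  by apply/funext => y; rewrite fct_sumE.
exact: is_derive_sum.
Qed.

(** * Bound on the truncated kernel, uniform in the position *)

Definition unit_mass (A : pzRingType) (i : int) : A := (i == 0)%:R.

(* Coefficients of the series of [cos (t y + th)] and [sin (t y + th)] in
   powers of [y]. *)
Definition cosD_coeff (R : realType) (t th : R) k : R :=
  cos th * cos_coeff t k - sin th * sin_coeff t k.

Definition sinD_coeff (R : realType) (t th : R) k : R :=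
  sin th * cos_coeff t k + cos th * sin_coeff t k.

(** The shift [th] allows one statement to serve the real and the imaginary part of the kernel and
    both signs of the time. *)
Lemma kernel_bound_pos (R : realType) : exists2 C : R, 0 < C &
  forall (t th : R) N (j : int), 0 < t ->
  `|\sum_(k < N) cosD_coeff t th k * lap2 k (@unit_mass R) j| <=
  C * t `^ (- 4^-1) + 2 * exp_tail (16 * t) N.
Proof.
have [C C0 hC] := increment_bilaplacian_phase R.
exists (C / pi); first by rewrite divr_gt0 ?pi_gt0.
move=> t th N j t0; set e := exp_tail (16 * t) N.
pose h (x : R) : R := (2 - 2 * cos x) ^+ 2.
have h16 x : `|t * h x| <= 16 * t.
  rewrite mulrC normrM (ger0_norm (ltW t0)) ler_pM2r// ger0_norm ?sqr_ge0//.
  have := cos_geN1 x; have := cos_le1 x; rewrite /h; nra.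
(* [F s] is a primitive of [f s], the truncated expansion of [cos (t * h x + s * j * x + th)] in
   powers of [h x]. *)
pose F (s x : R) : R := \sum_(k < N) (cosD_coeff t th k * lap2 k (cos_prim x) j -
  s * (sinD_coeff t th k * lap2 k (sin_prim x) j)).
pose f (s x : R) : R :=
  (cos th * series (cos_coeff (t * h x)) N -
   sin th * series (sin_coeff (t * h x)) N) * cos (j%:~R * x) -
  s * ((sin th * series (cos_coeff (t * h x)) N +
   cos th * series (sin_coeff (t * h x)) N) * sin (j%:~R * x)).
have F' (s x : R) : is_derive x 1 (F s) (f s x).
  have -> : f s x = \sum_(k < N)
    (cosD_coeff t th k * (h x ^+ k * cos (j%:~R * x)) -
     s * (sinD_coeff t th k * (h x ^+ k * sin (j%:~R * x)))).
    have e1 : cos th * series (cos_coeff (t * h x)) N -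
        sin th * series (sin_coeff (t * h x)) N =
        \sum_(k < N) cosD_coeff t th k * h x ^+ k.
      rewrite /series /= !big_mkord !mulr_sumr -sumrB; apply: eq_bigr => k _.
      by rewrite /cosD_coeff cos_coeffM sin_coeffM; ring.
    have e2 : sin th * series (cos_coeff (t * h x)) N +
        cos th * series (sin_coeff (t * h x)) N =
        \sum_(k < N) sinD_coeff t th k * h x ^+ k.
      rewrite /series /= !big_mkord !mulr_sumr -big_split/=.
      apply: eq_bigr => k _.
      by rewrite /sinD_coeff cos_coeffM sin_coeffM; ring.
    rewrite /f e1 e2 !mulr_suml mulr_sumr -sumrB; apply: eq_bigr => k _; ring.
  apply: (@is_derive_sum_fun _ N (fun k y =>
      cosD_coeff t th k * lap2 k (cos_prim y) j -
      s * (sinD_coeff t th k * lap2 k (sin_prim y) j))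
    (fun k => cosD_coeff t th k * (h x ^+ k * cos (j%:~R * x)) -
      s * (sinD_coeff t th k * (h x ^+ k * sin (j%:~R * x))))) => k.
  have hc : is_derive x 1 (fun y => lap2 k (cos_prim y) j)
      (h x ^+ k * cos (j%:~R * x)).
    have := lap2_cos k x 0 j; rewrite addr0 => <-.
    apply: is_derive_lap2 => i; rewrite addr0; exact: is_derive_cos_prim.
  have hs : is_derive x 1 (fun y => lap2 k (sin_prim y) j)
      (h x ^+ k * sin (j%:~R * x)).
    rewrite -lap2_sin.
    by apply: is_derive_lap2 => i; exact: is_derive_sin_prim.
  by apply: is_derive_eq.
have fe s x : s ^+ 2 = 1 ->
    `|f s x - cos (t * h x + (s * j%:~R) * x + th)| <= 2 * e.
  move=> s2.
  have ss : sin (s * (j%:~R * x)) = s * sin (j%:~R * x) /\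
            cos (s * (j%:~R * x)) = cos (j%:~R * x).
    have /orP[/eqP->|/eqP->] : (s == 1) || (s == -1).
      by rewrite -sqrf_eq1 s2.
      by rewrite !mul1r.
    by rewrite !mulN1r sinN cosN.
  (* The two truncation errors enter with factors of modulus at most 1, hence [2 * e]. *)
  have -> : f s x - cos (t * h x + (s * j%:~R) * x + th) =
    (series (cos_coeff (t * h x)) N - cos (t * h x)) *
      cos (th + s * (j%:~R * x)) -
    (series (sin_coeff (t * h x)) N - sin (t * h x)) *
      sin (th + s * (j%:~R * x)).
    rewrite -mulrA !cosD !sinD ss.1 ss.2 /f; ring.
  rewrite (le_trans (ler_normB _ _))// mulr_natl mulr2n lerD// normrM.
    rewrite -[leRHS]mulr1 ler_pM ?cos_max//.
    exact: series_cos_coeff_dist.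
  rewrite -[leRHS]mulr1 ler_pM ?sin_max//.
  exact: series_sin_coeff_dist.
have bnd s : s ^+ 2 = 1 -> `|F s pi - F s 0| <= C * t `^ (- 4^-1) + 2 * e * pi.
  move=> s2; apply: (hC t (s * j%:~R) th (2 * e) (F s) (f s)) => // x _.
  exact: fe.
(* Adding the cases [s = 1] and [s = -1] cancels the sine terms; [lap2_dirac] then produces the
   kernel. *)
have FE : (F 1 pi - F 1 0) + (F (-1) pi - F (-1) 0) =
    2 * pi * \sum_(k < N) cosD_coeff t th k * lap2 k (@unit_mass R) j.
  rewrite /F -!sumrB -big_split/= mulr_sumr; apply: eq_bigr => k _.
  have -> : 2 * pi * (cosD_coeff t th k * lap2 k (@unit_mass R) j) =
    2 * cosD_coeff t th k * (pi * lap2 k (@unit_mass R) j) by ring.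
  by rewrite -lap2_dirac; ring.
set S := \sum_(k < N) _ in FE *.
have p0 := pi_gt0 R.
have -> : S = ((F 1 pi - F 1 0) + (F (-1) pi - F (-1) 0)) / (2 * pi).
  by rewrite FE mulrAC mulfV ?mul1r// mulf_neq0// lt0r_neq0.
rewrite normrM normfV (gtr0_norm (_ : 0 < 2 * pi)) ?mulr_gt0//.
rewrite ler_pdivrMr ?mulr_gt0// (le_trans (ler_normD _ _))//.
rewrite (le_trans (lerD (bnd 1 _) (bnd (-1) _))) ?sqrrN ?expr1n//.
have Cp : C = C / pi * pi by rewrite divfK// lt0r_neq0.
rewrite le_eqVlt; apply/orP; left; apply/eqP; rewrite {1 2}Cp; ring.
Qed.

(** Both coefficient sequences are [cosD_coeff] at [|t|]: with shift 0 for the cosine, and with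
    shift [- (pi / 2)] or [pi / 2] for the sine, according to the sign of [t]. *)
Lemma kernel_bound (R : realType) : exists2 C : R, 0 < C &
  forall (t : R) N (j : int), t != 0 ->
  `|\sum_(k < N) cos_coeff t k * lap2 k (@unit_mass R) j| <=
    C * `|t| `^ (- 4^-1) + 2 * exp_tail (16 * `|t|) N /\
  `|\sum_(k < N) sin_coeff t k * lap2 k (@unit_mass R) j| <=
    C * `|t| `^ (- 4^-1) + 2 * exp_tail (16 * `|t|) N.
Proof.
have [C C0 hC] := kernel_bound_pos R; exists C => // t N j t0.
have cE k : cos_coeff t k = cosD_coeff `|t| 0 k.
  rewrite /cosD_coeff cos0 sin0 mul0r subr0 mul1r.
  have [//|_] := ger0P t.
  rewrite -[in RHS]mulrN1 cos_coeffM -signr_odd /cos_coeff/=.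
  by case: (odd k); rewrite ?mul0r ?mulr1.
have [s sE] : exists s : R, forall k, sin_coeff t k = cosD_coeff `|t| s k.
  have [_|_] := ger0P t.
    exists (- (pi / 2)) => k.
    by rewrite /cosD_coeff cosN sinN cos_pihalf sin_pihalf mul0r mulN1r opprK add0r.
  exists (pi / 2) => k.
  rewrite /cosD_coeff cos_pihalf sin_pihalf mul0r mul1r add0r.
  rewrite -(mulrN1 t) sin_coeffM -signr_odd /sin_coeff/=.
  by case: (odd k); rewrite ?mul0r ?oppr0 ?mulrN1 ?opprK.
split.
  under eq_bigr => k _ do rewrite cE; apply: hC; by rewrite normr_gt0.
under eq_bigr => k _ do rewrite sE; apply: hC; by rewrite normr_gt0.
Qed.

(** * From the kernel to the propagator *)

(** Euler's formula, coefficient by coefficient. *)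
Lemma exp_coeff_imaginary (R : realType) (t : R) k :
  (k`!%:R : R[i])^-1 * (- ('i * t%:C%C)) ^+ k =
  (cos_coeff t k)%:C%C - 'i * (sin_coeff t k)%:C%C.
Proof.
have sq m : (- ('i * t%:C%C)) ^+ m.*2 = ((-1) ^+ m * t ^+ m.*2)%:C%C :> R[i].
  rewrite -mul2n !exprM sqrrN [('i * _) ^+ 2]exprMn sqrCi exprMn.
  by rewrite !(rmorphM, rmorphXn, rmorphN, rmorph1).
have -> : (k`!%:R : R[i]) = (k`!%:R : R)%:C%C by rewrite rmorph_nat.
rewrite -fmorphV /cos_coeff /sin_coeff /=.
rewrite -exprnP.
have -> : (- ('i * t%:C%C)) ^+ k =
    (- ('i * t%:C%C)) ^+ (odd k + k./2.*2) :> R[i] by rewrite odd_double_half.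
case: (boolP (odd k)) => ok.
  rewrite exprS sq mul0r !mul0r rmorph0 sub0r mul1r.
  have -> : (k.-1./2 = k./2)%N by lia.
  have e : (k = k./2.*2.+1)%N by lia.
  rewrite [in t ^+ k]e exprS !(rmorphM, rmorphXn, rmorphN, rmorph1) /=; ring.
rewrite add0n sq !mul0r rmorph0 mulr0 subr0 mul1r.
have e : (k = k./2.*2)%N by lia.
by rewrite [in t ^+ k]e !(rmorphM, rmorphXn, rmorphN, rmorph1) /=; ring.
Qed.

Lemma iter_propagator_generator (R : realType) (c : R[i]) k (f : ell2 R) n :
  iter k (fun phi : ell2 R => c *: laplacian (laplacian phi)) f n =
  c ^+ k * lap2 k f n.
Proof.
elim: k n => [|k ih] n; first by rewrite mul1r.
rewrite iterS ell2ZE exprS -mulrA; congr (_ * _).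
set g := iter k _ f in ih *.
change (lap (lap g) n = c ^+ k * lap2 k.+1 f n).
rewrite lap2S (_ : (g : int -> R[i]) = fun j => c ^+ k * lap2 k f j).
  by rewrite /lap; ring.
exact/funext.
Qed.

(** By locality, [f] may be replaced by a finite sum of translated unit masses; linearity and
    translation invariance conclude. Any list [s] covering the range will do, so one list serves all
    [k < N]. *)
Lemma lap2_convolution (A : comPzRingType) k (f : int -> A) (n : int)
    (s : seq int) : uniq s ->
  (forall m, `|m - n| <= k.*2%:Z -> m \in s) ->
  lap2 k f n = \sum_(m <- s) f m * lap2 k (@unit_mass A) (n - m).
Proof.
move=> us hs.
transitivity (lap2 k (fun j => \sum_(m <- s) f m * unit_mass A (j - m)) n).
  apply: lap2_local => m /hs ms.
  rewrite (bigD1_seq m)//= subrr /unit_mass eqxx mulr1 big1 ?addr0// => i im.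
  by rewrite subr_eq0 eq_sym (negbTE im) mulr0.
elim: s {us hs} => [|m s ih].
  rewrite big_nil; under eq_fun do rewrite big_nil.
  have := lap2_lin k 0 0 (fun=> 0 : A) (fun=> 0) n.
  by rewrite !mul0r addr0.
rewrite big_cons -ih -lap2_shift -[X in _ + X]mul1r -lap2_lin.
by congr lap2; apply/funext => j; rewrite big_cons mul1r.
Qed.

Lemma normc_le_ReIm (R : realType) (a b : R) :
  normc (a%:C%C - 'i * b%:C%C) <= `|a| + `|b|.
Proof.
have i1 : normc ('i : R[i]) = 1.
  have : normc (('i : R[i]) ^+ 2) = 1.
    by rewrite sqrCi normcN normc1.
  rewrite expr2 normcM -expr2 => /eqP.
  rewrite sqrf_eq1 => /orP[/eqP//|/eqP e].
  by have := normc_ge0 ('i : R[i]); rewrite e oppr_ge0 leNgt ltr01.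
have nC (x : R) : normc (x%:C%C) = `|x|.
  by rewrite /= expr0n/= addr0 sqrtr_sqr.
apply: (le_trans (le_normcD _ _)).
by rewrite normcN normcM i1 mul1r !nC.
Qed.

Lemma sum_normc_le_lnorm1 (R : realType) (f : int -> R[i]) (s : seq int) :
  uniq s -> (lnorm 1%:E f <= 1)%E -> \sum_(m <- s) normc (f m) <= 1.
Proof.
move=> us; rewrite /lnorm invr1 poweRe1; last first.
  by apply: esum_ge0 => n _; rewrite lee_fin powR_ge0.
move=> f1; rewrite -lee_fin; apply: le_trans f1.
apply: ereal_sup_ubound; exists [set` s]; first by split; [exact: finite_seq|].

rewrite -fsbig_seq// sumEFin; congr EFin; apply: eq_bigr => m _.
by rewrite powRr1 ?normc_ge0.
Qed.

Lemma l2_le1_lnorm1 (R : realType) (f : int -> R[i]) :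
  (lnorm 1%:E f <= 1)%E -> l2_le f 1.
Proof.
move=> f1; split=> // X; rewrite expr1n.
have X1 := sum_normc_le_lnorm1 (fset_uniq X) f1.
apply: le_trans X1; apply: ler_sum => n _.
have := sum_normc_le_lnorm1 (isT : uniq [:: n]) f1.
rewrite big_seq1 => fn1.
by rewrite expr2 ler_piMr ?normc_ge0.
Qed.

(** A truncated series is a convolution with a kernel [K], so a uniform bound on [K] passes to l^1
    data. Real and imaginary parts double the constants. *)
Lemma exp_partial_bound (R : realType) : exists2 C : R, 0 < C &
  forall (t : R) N (f : ell2 R) n, t != 0 -> (lnorm 1%:E f <= 1)%E ->
  normc (exp_partial
    (fun phi => (- ('i * t%:C%C)) *: laplacian (laplacian phi)) N f n) <=
  C * `|t| `^ (- 4^-1) + 4 * exp_tail (16 * `|t|) N.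
Proof.
have [C C0 hC] := kernel_bound R.
exists (2 * C); first by rewrite mulr_gt0.
move=> t N f n t0 f1.
set B := _ + _.
pose K j : R[i] := (\sum_(k < N) cos_coeff t k * lap2 k (@unit_mass R) j)%:C%C -
  'i * (\sum_(k < N) sin_coeff t k * lap2 k (@unit_mass R) j)%:C%C.
have KB j : normc (K j) <= B.
  have [h1 h2] := hC t N j t0.
  rewrite (le_trans (normc_le_ReIm _ _))// (le_trans (lerD h1 h2))// /B; lra.
have KE j : K j = \sum_(k < N) (k`!%:R)^-1 * ((- ('i * t%:C%C)) ^+ k *
    lap2 k (@unit_mass R[i]) j).
  rewrite /K !rmorph_sum/= mulr_sumr -sumrB; apply: eq_bigr => k _.
  rewrite mulrA exp_coeff_imaginary !rmorphM/=.
  have -> : lap2 k (@unit_mass R[i]) j = (lap2 k (@unit_mass R) j)%:C%C.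
    rewrite -lap2_rmorph; congr lap2; apply/funext => i.
    by rewrite /unit_mass rmorph_nat.
  ring.
(* The window of radius [N.*2] around [n] contains every site reached by the powers [k < N]. *)
pose s := [seq n - (N.*2)%:Z + i%:Z | i <- iota 0 (N.*2 + N.*2).+1].
have us : uniq s.
  by rewrite map_inj_uniq ?iota_uniq// => i j /addrI [].
have hs k m : (k < N)%N -> `|m - n| <= k.*2%:Z -> m \in s.
  move=> kN mn; apply/mapP; exists (absz (m - n + (N.*2)%:Z)).
    by rewrite mem_iota; lia.
  lia.
have -> : exp_partial (fun phi => (- ('i * t%:C%C)) *:
    laplacian (laplacian phi)) N f n = \sum_(m <- s) f m * K (n - m).
  rewrite [LHS](ell2_sumE N (fun k => (k`!%:R)^-1 *: iter k
    (fun phi => (- ('i * t%:C%C)) *: laplacian (laplacian phi)) f)).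
  under [RHS]eq_bigr => m _ do rewrite KE mulr_sumr.
  rewrite exchange_big/=; apply: eq_bigr => k _.
  transitivity ((k`!%:R)^-1 * iter k (fun phi : ell2 R =>
    (- ('i * t%:C%C)) *: laplacian (laplacian phi)) f n); first by [].
  rewrite iter_propagator_generator.
  rewrite (@lap2_convolution _ k f n s us) => [|m]; last exact: hs.
  rewrite !mulr_sumr; apply: eq_bigr => m _; ring.
have Bs : normc (\sum_(m <- s) f m * K (n - m)) <=
    (\sum_(m <- s) normc (f m)) * B.
  elim: (s) => [|m r ih]; first by rewrite !big_nil normc0 mul0r.
  rewrite !big_cons (le_trans (le_normcD _ _))// mulrDl lerD//.
  by rewrite normcM ler_wpM2l ?normc_ge0.
apply: (le_trans Bs); rewrite ler_piMl//.
  exact: le_trans (normc_ge0 _) (KB 0).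
exact: sum_normc_le_lnorm1.
Qed.

Theorem theorem3p1 (R : realType) :
  exists2 c : R, 0 < c &
    forall t : R, t != 0 ->
      (opnorm 1%:E +oo (propagator t) <= (c * `|t| `^ (- 4^-1))%:E)%E.
Proof.
have [C C0 hC] := exp_partial_bound R; exists C => // t t0.
apply: ge_ereal_sup => _ [f /= f1 <-].
apply: ge_ereal_sup => _ [n _ <-]; rewrite lee_fin.
apply/ler_addgt0Pr => e e0.
have e2 : 0 < e / 2 by rewrite divr_gt0.
have e8 : 0 < e / 8 by rewrite divr_gt0.
have [_ hU] := propagatorP t.
set P := exp_partial _ in hU.
have UP : \forall N \near \oo,
    (opnorm 2%:E 2%:E (fun phi => propagator t phi - P N phi)%R < (e / 2)%:E)%E.
  apply: (hU [set x | (x < (e / 2)%:E)%E]); apply: open_nbhs_nbhs.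
  by split; [exact: open_ereal_lt_ereal|rewrite /= lte_fin].
suff : \forall N \near \oo,
    normc (propagator t f n) <= C * `|t| `^ (- 4^-1) + e.
  by case/filter_ex.
near=> N.
(* The l^1 unit ball lies in the l^2 unit ball, so convergence in operator norm applies to [f]; the
   l^2 norm then bounds the value at [n]. *)
have h1 : l2_le (propagator t f - P N f) (e / 2).
  apply/lnorm2_le; first exact: ltW.
  have /ltW : (opnorm 2%:E 2%:E
      (fun phi => propagator t phi - P N phi)%R < (e / 2)%:E)%E by near: N.
  apply: le_trans; apply: ereal_sup_ubound; exists f => //=.
  by apply/lnorm2_le1; exact: l2_le1_lnorm1.
(* The remainder enters with a factor 4, so [e / 8] contributes [e / 2]. *)
have h2 : exp_tail (16 * `|t|) N <= e / 8.
  by near: N; apply: (cvgr_le _ (@exp_tail_cvg0 _ (16 * `|t|))).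
have h3 := hC t N f n t0 f1.
have := l2_le_pt n h1; rewrite ell2DE ell2NE => h4.
rewrite -(subrK (P N f n) (propagator t f n)).
rewrite (le_trans (le_normcD _ _))// (le_trans (lerD h4 h3))//; lra.
Unshelve. all: by end_near. Qed.
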